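(* Let $(M^d,g)$ be a compact Riemannian manifold of dimension $d$ with Laplace–Beltrami eigenvalues $\lambda_n(-\Delta_g)$, let $\epsilon>0$, and define the encoded spectrum $$C_n^{\mathrm{enc}}(M,g):=\pi-\epsilon\,\lambda_n(-\Delta_g).$$ Let $$N_{\mathrm{enc}}(C):=\#\{n:\ C_n^{\mathrm{enc}}\ge C\},\qquad \rho_{\mathrm{enc}}(C):=-\frac{d}{dC}N_{\mathrm{enc}}(C)$$ in the distributional sense. If Weyl asymptotics holds on $M^d$, then as $C\to-\infty$, $$N_{\mathrm{enc}}(C)\sim A_d\,(\pi-C)^{d/2},\qquad \rho_{\mathrm{enc}}(C)\sim\frac d2\,A_d\,(\pi-C)^{(d-2)/2},$$ for a positive constant $A_d$ depending on $d$, $\epsilon$ and the Weyl constant of $(M^d,g)$. Hence, within the class of affinely encoded spectra $\pi-\epsilon\lambda_n$ for which Weyl asymptotics holds, the exponent of $\rho_{\mathrm{enc}}$ determines the geometric dimension $d$.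
   Context: The eigenvalues $0=\lambda_0\le\lambda_1\le\lambda_2\le\cdots$ of $-\Delta_g$ are counted with multiplicity. ''Weyl asymptotics holds'' means $\lambda_n(-\Delta_g)\sim\gamma_d(g)\,n^{2/d}$ as $n\to\infty$ for a positive constant $\gamma_d(g)$, the Weyl constant. The asymptotics for $\rho_{\mathrm{enc}}$ is understood in the Stieltjes/distributional sense, as the derivative of the asymptotics of the counting function. *)

(* Defs.v *)
From mathcomp Require Import all_boot all_order all_algebra.
From mathcomp Require Import finmap.
From mathcomp Require Import all_classical all_reals all_analysis.

Set Implicit Arguments.
Unset Strict Implicit.
Unset Printing Implicit Defensive.

Import Order.TTheory GRing.Theory Num.Theory.
Import numFieldNormedType.Exports.

Local Open Scope classical_set_scope.
Local Open Scope card_scope.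
Local Open Scope ring_scope.

(* For the Landau notations at +oo and -oo. *)
Canonical pinfty_filter_on (R : numFieldType) :=
  FilterType (pinfty_nbhs R) (@proper_pinfty_nbhs R).
Canonical ninfty_filter_on (R : numFieldType) :=
  FilterType (ninfty_nbhs R) (@proper_ninfty_nbhs R).

Section Calculus.
Variables (R : realType) (d : nat).
Implicit Types (U : set 'rV[R]_d) (f : 'rV[R]_d -> R).

Definition partial (a : 'I_d) f : 'rV[R]_d -> R := 'D_(delta_mx 0 a) f.

(* [U] is meant to be open; values of [f] outside [U] are irrelevant. *)
Fixpoint Ck_on (k : nat) U f : Prop :=
  (forall x, U x -> {for x, continuous f}) /\
  if k is k'.+1 then
    forall a : 'I_d,
      (forall x, U x -> derivable f x (delta_mx 0 a)) /\
      Ck_on k' U (partial a f)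
  else True.

Definition smooth_on U f : Prop := forall k, Ck_on k U f.

End Calculus.

(* Closed (compact, without boundary) smooth manifolds.  Second countability
   is automatic for a compact locally Euclidean space.  [param i] is the inverse
   of the chart [coord i] on [coord i @` dom i]; both functions are total, with
   irrelevant values off their domains. *)
Record closedManifold (R : realType) (d : nat) := ClosedManifold {
  carrier :> topologicalType;
  chart : Type;
  dom : chart -> set carrier;
  coord : chart -> carrier -> 'rV[R]_d;
  param : chart -> 'rV[R]_d -> carrier;
  manifold_hausdorff : hausdorff_space carrier;
  manifold_compact : compact [set: carrier];
  chart_cover : forall p : carrier, exists i, dom i p;
  dom_open : forall i, open (dom i);
  image_open : forall i, open (coord i @` dom i);
  coord_continuous : forall i p, dom i p -> {for p, continuous (coord i)};
  param_continuous : forall i x,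
    (coord i @` dom i) x -> {for x, continuous (param i)};
  coordK : forall i p, dom i p -> param i (coord i p) = p;
  transition_smooth : forall (i j : chart) (k : 'I_d),
    smooth_on (coord i @` (dom i `&` dom j))
      (fun x => coord j (param i x) 0 k)
}.

(* The metric is given by its Gram matrix in each chart.  The library's Jacobian
   ['J f x] acts on row vectors from the right, so its [(a, k)] entry is the
   derivative of the [k]-th component of [f] in direction [a], and the
   tensor transformation law reads [g_i = J *m g_j *m J^T]. *)
Record riemannianManifold (R : realType) (d : nat) := RiemannianManifold {
  manifold :> closedManifold R d;
  metric : chart manifold -> 'rV[R]_d -> 'M[R]_d;
  metric_smooth : forall i (a b : 'I_d),
    smooth_on (coord i @` dom i) (fun x => metric i x a b);
  metric_sym : forall i x, (coord i @` dom i) x -> (metric i x)^T = metric i x;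
  metric_posdef : forall i x (v : 'rV[R]_d), (coord i @` dom i) x -> v != 0 ->
    0 < (v *m metric i x *m v^T) 0 0;
  metric_transition : forall (i j : chart manifold) x,
    (coord i @` (dom i `&` dom j)) x ->
    let tau := fun y => coord j (param i y) in
    metric i x = 'J tau x *m metric j (tau x) *m ('J tau x)^T
}.

Section LaplaceBeltrami.
Variables (R : realType) (d : nat) (M : riemannianManifold R d).
Implicit Types (u : M -> R) (mu : R) (lambda : nat -> R).

Definition smooth u : Prop :=
  forall i : chart M, smooth_on (coord i @` dom i) (u \o param i).

(* Laplace-Beltrami operator in the chart [i], with [g = metric i]:
   |g|^(-1/2) sum_(a,b) d_a (|g|^(1/2) g^(ab) d_b u). *)
Definition laplacian (i : chart M) u (p : M) : R :=
  let g := metric i in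
  let x := coord i p in
  (Num.sqrt (\det (g x)))^-1 *
  \sum_(a < d) partial a
    (fun y => Num.sqrt (\det (g y)) *
      \sum_(b < d) invmx (g y) a b * partial b (u \o param i) y) x.

(* The local expressions agree on overlaps, so imposing the equation
   in every chart is the global equation - Delta u = mu u. *)
Definition eigenspace mu : set (M -> R) :=
  [set u | smooth u /\
    forall i p, dom i p -> - laplacian i u p = mu * u p].

Definition has_dim (E : set (M -> R)) (m : nat) : Prop :=
  exists b : 'I_m -> M -> R, (forall k, E (b k)) /\
    forall u, E u ->
      exists! c : 'rV[R]_m, forall p, u p = \sum_(k < m) c 0 k * b k p.

(* [lambda] lists the eigenvalues of - Delta in nondecreasing order, each
   repeated according to its (finite) multiplicity. *)
Definition laplace_spectrum lambda : Prop :=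
  [/\ lambda 0%N = 0,
      {homo lambda : m n / (m <= n)%N >-> m <= n} &
      forall mu, exists m, has_dim (eigenspace mu) m /\
        [set n | lambda n = mu] #= `I_m].

End LaplaceBeltrami.

Section Encoding.
Variable R : realType.
Implicit Types (lambda : nat -> R) (N f phi : R -> R).

Definition weyl_asymptotics (d : nat) (gamma : R) lambda : Prop :=
  lambda ~_(\oo) (fun n => gamma * n%:R `^ (2 / d%:R)).

Definition C_enc (eps : R) lambda (n : nat) : R := pi - eps * lambda n.

(* [fset_set] of an infinite set is empty. *)
Definition N_enc (eps : R) lambda (C : R) : R :=
  (#|` fset_set [set n | C <= C_enc eps lambda n]|)%fset%:R.

Definition test_function phi : Prop :=
  (forall n x, derivable (derive1n n phi) x 1) /\
  exists a b, forall x, phi x != 0 -> a <= x <= b.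

(* - dN/dC as a distribution: <- N', phi> = <N, phi'>. *)
Definition neg_distr_derivative N phi : R :=
  \int[lebesgue_measure]_x (N x * derive1 phi x).

Definition rho_enc (eps : R) lambda : (R -> R) -> R :=
  neg_distr_derivative (N_enc eps lambda).

(* The mass that the Stieltjes measure - dN puts on [C, C0[ (for N
   nonincreasing and left-continuous, it is N C - N C0) is asymptotic to
   the mass that the density f puts there, for any fixed C0 < pi. *)
Definition stieltjes_equiv N f : Prop :=
  forall C0, C0 < pi ->
    (fun C => N C - N C0) ~_(-oo)
    (fun C => \int[lebesgue_measure]_(x in `[C, C0]) f x).

(* T ~ f at -oo as distributions: T and f have equivalent pairings with
   any nonzero nonnegative test function supported in ]-oo, 0[ and rescaled
   by L -> +oo, which pushes its support to -oo. *)
Definition distr_equiv (T : (R -> R) -> R) f : Prop :=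
  forall phi, test_function phi -> (forall x, 0 <= phi x) ->
    (exists x, phi x != 0) ->
    (exists2 b, b < 0 & forall x, phi x != 0 -> x <= b) ->
    (fun L => T (fun x => phi (x / L))) ~_(+oo)
    (fun L => \int[lebesgue_measure]_x (f x * phi (x / L))).

End Encoding.

(* Main.v *)
(* Put h = d/2 and mu_n = (lambda_n / gamma)^h, so that Weyl asymptotics reads
   mu_n ~ n.  Since C <= pi - eps lambda_n amounts to
   mu_n <= (eps gamma)^(-h) (pi - C)^h, counting gives
   N(C) ~ F(C) := A (pi - C)^h with A = (eps gamma)^(-h).
   The density f := h A (pi - C)^(h-1) is - F'.  Integrating f over [C, C0] gives
   the Stieltjes asymptotics.  For a test function phi and psi(x) = phi(x / L),
   integration by parts turns <- N', psi> - <f, psi> into the integral of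
   (N - F) psi', which is o(L^h), while <f, psi> >= c L^h.
   The exponent: integrating B (pi - x)^alpha over [pi - 2t, pi - t], or against
   psi, gives a quantity of exact order alpha + 1 in t, resp. L, and it has to
   be of order h as well.  The distributional case requires one smooth bump. *)
Require Import Defs.
From mathcomp Require Import all_boot all_order all_algebra.
From mathcomp Require Import all_classical all_reals all_analysis.
From mathcomp Require Import measurable_realfun.
From mathcomp Require Import ring lra.

Import Order.TTheory GRing.Theory Num.Theory.
Import numFieldNormedType.Exports.

Local Open Scope classical_set_scope.
Local Open Scope ring_scope.

(** * Counting the eigenvalues *)

Lemma equivP (R : realType) (T : Type) (F : filter_on T) (f g : T -> R) :
  f ~_F g <->
  forall e, 0 < e -> \forall x \near F, `|f x - g x| <= e * `|g x|.
Proof. by split=> [/eqaddoP h e /h|h]; last exact/eqaddoP. Qed.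

Lemma near_pinftyP (R : realType) (P : R -> Prop) :
  (\forall x \near +oo, P x) <-> exists T, forall x, T <= x -> P x.
Proof.
split=> [[T [_ TP]]|[T TP]].
  by exists (T + 1) => x Tx; apply: TP; lra.
by exists T; split => [|x /ltW /TP//]; exact: num_real.
Qed.

Lemma near_ninftyP (R : realType) (P : R -> Prop) :
  (\forall x \near -oo, P x) <-> exists T, forall x, x <= T -> P x.
Proof.
split=> [[T [_ TP]]|[T TP]].
  by exists (T - 1) => x Tx; apply: TP; lra.
by exists T; split => [|x /ltW /TP//]; exact: num_real.
Qed.

Lemma equiv_ninftyP (R : realType) (f g : R -> R) :
  f ~_(-oo) g <->
  forall e, 0 < e -> exists T, forall x, x <= T ->
    `|f x - g x| <= e * `|g x|.
Proof.
split=> [/equivP h e /h/near_ninftyP//|h].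
by apply/equivP => e /h ?; exact/near_ninftyP.
Qed.

Lemma equiv_pinftyP (R : realType) (f g : R -> R) :
  f ~_(+oo) g <->
  forall e, 0 < e -> exists T, forall x, T <= x ->
    `|f x - g x| <= e * `|g x|.
Proof.
split=> [/equivP h e /h/near_pinftyP//|h].
by apply/equivP => e /h ?; exact/near_pinftyP.
Qed.

(** The count [m] is trapped by [mu (m-1) <= X < mu m]. Both ends are within a small relative error
    of their index, and the shift by one is absorbed for large [X]. *)
Lemma counting_equiv (R : realType) (mu : nat -> R) :
  mu ~_(\oo) (fun n => n%:R : R) ->
  forall e, 0 < e -> exists X0, forall X (m : nat), X0 <= X ->
    (forall n, (mu n <= X) = (n < m)%N) -> `|m%:R - X| <= e * X.
Proof.
move=> /equivP mun e e0.
pose de := Num.min (e / 4) (2^-1).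
have de0 : 0 < de by rewrite lt_min; apply/andP; split; lra.
have dee : de <= e / 4 by rewrite ge_min lexx.
have de2 : de <= 2^-1 by rewrite ge_min lexx orbT.
have [n0 _ n0P] := mun _ de0.
(* [X >= mu n0] forces [n0 < m], so that the estimate also applies at the index [m-1]; [X >= 2 / e]
   bounds the unit shift by [e / 2 * X]. *)
exists (Num.max (mu n0) (2 / e)) => X m; rewrite ge_max => /andP[X1 X2] mP.
have X0 : 1 <= e / 2 * X by move: X2; rewrite ler_pdivrMr//; lra.
have Xp : 0 < X by nra.
have n0m : (n0 < m)%N by rewrite -mP.
case: m => // m in mP n0m *.
have := n0P m.+1 (ltnW n0m); have := n0P m n0m.
rewrite /= !(ger0_norm (ler0n _ _)) !ler_norml => /andP[m1 m2] /andP[m3 m4].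
have mX : mu m <= X by rewrite mP.
have Xm : X < mu m.+1 by rewrite ltNge mP ltnn.
move: m1 m2 m3 m4; rewrite -[m.+1%:R]natr1; set M := m%:R => *.
have M0 : 0 <= M by exact: ler0n.
apply/andP; split; nra.
Qed.

(** The increasing map [x ^ h] sends [[u, v]] onto [[1 - e1, 1 + e1]], where [u < 1 < v] are the
    [h]-th roots of these ends. The relative error allowed for [lambda] is therefore the distance
    from 1 to the nearer of [u] and [v]. *)
Lemma powR_equiv (R : realType) (h gamma : R) (lambda : nat -> R) :
  0 < h -> 0 < gamma -> (forall n, 0 <= lambda n) ->
  lambda ~_(\oo) (fun n => gamma * n%:R `^ h^-1) ->
  (fun n => (lambda n / gamma) `^ h) ~_(\oo) (fun n => n%:R : R).
Proof.
move=> h0 g0 l0 /equivP lg; apply/equivP => e e0.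
pose e1 := Num.min e (2^-1).
have e10 : 0 < e1 by rewrite lt_min; apply/andP; split; lra.
have e1e : e1 <= e by rewrite ge_min lexx.
have e12 : e1 <= 2^-1 by rewrite ge_min lexx orbT.
have hV0 : 0 < h^-1 by rewrite invr_gt0.
pose u := (1 - e1) `^ h^-1; pose v := (1 + e1) `^ h^-1.
have powK x : 0 <= x -> (x `^ h^-1) `^ h = x.
  by move=> x0; rewrite -powRrM mulVf ?gt_eqF// powRr1.
have p1 : 1 `^ h^-1 = 1 :> R by rewrite powR1.
have u1 : u < 1.
  by rewrite -[ltRHS]p1 gt0_ltr_powR// ?nnegrE; lra.
have v1 : 1 < v.
  by rewrite -[ltLHS]p1 gt0_ltr_powR// ?nnegrE; lra.
have u0 : 0 <= u by exact: powR_ge0.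
have d0 : 0 < Num.min (1 - u) (v - 1) by rewrite lt_min; apply/andP; split; lra.
have := lg _ d0; set de := Num.min _ _ in d0 *.
have du : de <= 1 - u by rewrite ge_min lexx.
have dv : de <= v - 1 by rewrite ge_min lexx orbT.
apply: filterS => n.
have N0 : 0 <= n%:R `^ h^-1 by exact: powR_ge0.
rewrite (ger0_norm (ler0n _ _)) (ger0_norm (mulr_ge0 (ltW g0) N0)).
rewrite !ler_norml => /andP[n1 n2].
have lo : u * n%:R `^ h^-1 <= lambda n / gamma by rewrite ler_pdivlMr//; nra.
have up : lambda n / gamma <= v * n%:R `^ h^-1 by rewrite ler_pdivrMr//; nra.
have lg0 : 0 <= lambda n / gamma by rewrite divr_ge0// ltW.
have v0 : 0 <= v by lra.
have N_h w : 0 <= w -> (w `^ h^-1 * n%:R `^ h^-1) `^ h = w * n%:R.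
  by move=> w0; rewrite powRM ?powR_ge0// !powK.
have : u * n%:R `^ h^-1 \is Num.nneg by rewrite nnegrE mulr_ge0.
have : v * n%:R `^ h^-1 \is Num.nneg by rewrite nnegrE mulr_ge0.
move=> vn un.
have := ge0_ler_powR (ltW h0) un _ lo; rewrite /= N_h; last lra.
have := ge0_ler_powR (ltW h0) _ vn up; rewrite /= N_h; last lra.
rewrite nnegrE => /(_ lg0) h1 /(_ lg0) h2.
have := ler0n R n; nra.
Qed.

Section EncodedCounting.
Variables (R : realType) (eps : R) (lambda : nat -> R).
Hypotheses (eps0 : 0 < eps) (lambda_homo : {homo lambda : m n / (m <= n)%N >-> m <= n}).
Hypothesis lambda_unbounded : forall s, exists n, s < lambda n.

(** Unboundedness gives a first index [m] that is not counted, and monotonicity makes the counted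
    set the initial segment [I_m]. Being finite, this set escapes the default value of
    [fset_set]. *)
Lemma N_enc_count C : exists m : nat,
  N_enc eps lambda C = m%:R /\ forall n, (C <= pi - eps * lambda n) = (n < m)%N.
Proof.
have exP : exists n, ~~ (C <= pi - eps * lambda n).
  have [n nP] := lambda_unbounded ((pi - C) / eps).
  by exists n; rewrite -ltNge; move: nP; rewrite ltr_pdivrMr//; lra.
pose m := ex_minn exP.
have mP n : (C <= pi - eps * lambda n) = (n < m)%N.
  rewrite /m; case: ex_minnP => k kP kmin.
  apply/idP/idP => [nC|nk].
    rewrite ltnNge; apply: contra kP => kn.
    apply: le_trans nC _; rewrite lerD2l lerN2 ler_pM2l//; exact: lambda_homo.
  by apply: contraLR nk => /kmin; rewrite -leqNgt.
exists m; split=> //; rewrite /N_enc.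
suff -> : [set n | C <= C_enc eps lambda n] = `I_m.
  by congr (_%:R); exact: card_fset_set (card_eqxx _).
by apply/seteqP; split => n /=; rewrite /C_enc mP.
Qed.

Lemma N_enc_nonincreasing : {homo N_enc eps lambda : x y /~ x <= y}.
Proof.
move=> y x xy.
have [m [-> mP]] := N_enc_count y; have [k [-> kP]] := N_enc_count x.
rewrite ler_nat leqNgt; apply/negP => km.
by have := ltnn k; rewrite -kP (le_trans xy)// mP.
Qed.

End EncodedCounting.

Lemma N_enc_equiv (R : realType) (d : nat) (eps gamma : R) (lambda : nat -> R) :
  (0 < d)%N -> 0 < eps -> 0 < gamma -> lambda 0%N = 0 ->
  {homo lambda : m n / (m <= n)%N >-> m <= n} ->
  weyl_asymptotics d gamma lambda ->
  (forall s, exists n, s < lambda n) /\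
  N_enc eps lambda ~_(-oo)
    (fun C : R => (eps * gamma) `^ (- (d%:R / 2)) * (pi - C) `^ (d%:R / 2)).
Proof.
move=> d0 eps0 g0 l0 lh weyl.
have ln0 n : 0 <= lambda n by rewrite -l0 lh.
pose h : R := d%:R / 2.
have h0 : 0 < h by rewrite divr_gt0// ltr0n.
have hV : 2 / d%:R = h^-1 by rewrite invf_div.
have mun : (fun n => (lambda n / gamma) `^ h) ~_(\oo) (fun n => n%:R : R).
  by apply: powR_equiv => //; rewrite -hV.
(* Eventually [mu_n >= n / 2], whereas [lambda n <= s] would give [mu_n <= S]; an index above
   [2 * S] is thus a witness. *)
have lub s : exists n, s < lambda n.
  have := (equivP _ _ _ _ _).1 mun 2^-1 ltac:(lra) => -[n0 _ n0P].
  pose S := (`|s| / gamma) `^ h.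
  have [k kP] : exists k : nat, 2 * S < k%:R.
    by exists (Num.truncn (2 * S)).+1; rewrite truncnS_gt.
  exists (maxn n0 k); have := n0P (maxn n0 k) (leq_maxl _ _).
  set n := maxn n0 k; rewrite /= (ger0_norm (ler0n _ _)) ler_norml => /andP[n1 _].
  have kn : k%:R <= n%:R :> R by rewrite ler_nat leq_maxr.
  rewrite ltNge; apply/negP => lns.
  have : (lambda n / gamma) `^ h <= S.
    apply: ge0_ler_powR; rewrite ?nnegrE ?divr_ge0 ?(ltW h0) ?(ltW g0)//.
    apply: ler_wpM2r; first by rewrite invr_ge0 ltW.
    exact: le_trans lns (ler_norm _).
  lra.
split=> //; apply/equiv_ninftyP => e e0.
have [X0 X0P] := counting_equiv _ _ mun _ e0.
have hi0 : 0 < h^-1 by rewrite invr_gt0.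
(* Below this threshold the [h]-th power of [(pi - C) / (eps * gamma)] is at least [X0]; the maximum
   with 0 keeps the base of the power nonnegative. *)
exists (pi - eps * gamma * (Num.max X0 0) `^ h^-1) => C CX.
have [m [-> mP]] := N_enc_count _ _ _ eps0 lh lub C.
have Xi0 : 0 <= (Num.max X0 0) `^ h^-1 by exact: powR_ge0.
have eg0 : 0 < eps * gamma by exact: mulr_gt0.
have C0 : 0 <= pi - C by nra.
have XE : (eps * gamma) `^ (- (d%:R / 2)) * (pi - C) `^ (d%:R / 2) =
   ((pi - C) / (eps * gamma)) `^ h.
  rewrite [RHS]powRM ?invr_ge0 ?(ltW eg0)// mulrC.
  by rewrite -(powR_inv1 (ltW eg0)) -powRrM mulN1r.
rewrite XE [in leRHS]ger0_norm ?powR_ge0//; apply: X0P.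
  apply: (@le_trans _ _ (Num.max X0 0)); first by rewrite le_max lexx.
  have m0 : 0 <= Num.max X0 0 by rewrite le_max lexx orbT.
  rewrite -[leLHS]powRr1// -[1](mulVf (lt0r_neq0 h0)) powRrM.
  apply: ge0_ler_powR; rewrite ?(ltW h0)// ?nnegrE ?divr_ge0 ?(ltW eg0)//.
  by rewrite ler_pdivlMr//; lra.
move=> n; rewrite -mP.
have -> : (C <= pi - eps * lambda n) = (lambda n / gamma <= (pi - C) / (eps * gamma)).
  rewrite ler_pdivrMr//.
  rewrite (_ : (pi - C) / (eps * gamma) * gamma = (pi - C) / eps); last first.
    by field; rewrite !gt_eqF.
  by rewrite ler_pdivlMr//; apply/idP/idP; lra.
apply/idP/idP => [|].
  apply: contraTT; rewrite -!ltNge.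
  by apply: gt0_ltr_powR; rewrite ?nnegrE ?divr_ge0 ?(ltW h0) ?(ltW g0) ?(ltW eg0).
by apply: ge0_ler_powR; rewrite ?nnegrE ?divr_ge0 ?(ltW h0) ?(ltW g0) ?(ltW eg0).
Qed.

(** * Powers and integrals over segments *)

Lemma derivable_continuous (R : realType) (f : R -> R) x :
  derivable f x 1 -> {for x, continuous f}.
Proof. by move=> df; exact/differentiable_continuous/derivable1_diffP. Qed.

Section PowerEstimates.
Variable R : realType.
Implicit Types (al h p t u v L : R).

(** A power is monotone on the positive reals, so its extremes over [[u * L, v * L]] are at the
    ends. The sign of [al] decides which end gives [k1], and both signs occur because the exponent
    to be identified is arbitrary. *)
Lemma powR_bounds al u v : 0 < u -> u <= v ->
  exists k1 k2, [/\ 0 < k1, 0 < k2 & forall L t, 0 < L -> u * L <= t <= v * L ->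
    k1 * L `^ al <= t `^ al <= k2 * L `^ al].
Proof.
move=> u0 uv; have v0 : 0 < v by exact: lt_le_trans uv.
have scale w L : 0 < w -> 0 < L -> w `^ al * L `^ al = (w * L) `^ al.
  by move=> w0 L0; rewrite powRM// ltW.
have [al0|al0] := leP 0 al.
  exists (u `^ al), (v `^ al); split; rewrite ?powR_gt0// => L t L0 /andP[ut tv].
  rewrite !scale//; have uL : 0 < u * L by exact: mulr_gt0.
  have t0 : 0 < t by exact: lt_le_trans ut.
  by rewrite !ge0_ler_powR// nnegrE ltW// mulr_gt0.
exists (v `^ al), (u `^ al); split; rewrite ?powR_gt0// => L t L0 /andP[ut tv].
rewrite !scale//; have uL : 0 < u * L by exact: mulr_gt0.
have t0 : 0 < t by exact: lt_le_trans ut.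
have vL : 0 < v * L by exact: mulr_gt0.
rewrite -[al]opprK [in X in X && _]powRN [(t `^ _) in X in X && _]powRN.
rewrite [in X in _ && X]powRN [(u * L) `^ _ in X in _ && X]powRN.
by rewrite !lef_pV2 ?posrE ?powR_gt0// !ge0_ler_powR// ?nnegrE ?ltW// oppr_gt0.
Qed.

Lemma powR_unbounded p K T : 0 < p -> exists t, [/\ T <= t, 1 <= t & K < t `^ p].
Proof.
move=> p0; pose s := (`|K| + 1) `^ p^-1; pose t := Num.max s (Num.max T 1).
exists t; split; rewrite ?le_max ?lexx ?orbT//.
have K0 : 0 <= `|K| by exact: normr_ge0.
have st : s `^ p <= t `^ p.
  apply: ge0_ler_powR; rewrite ?nnegrE ?powR_ge0 ?(ltW p0)//.
  - by rewrite !le_max ler01 !orbT.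
  - by rewrite le_max lexx.
apply: lt_le_trans st; rewrite /s -powRrM mulVf ?gt_eqF// powRr1; last lra.
by have := ler_norm K; lra.
Qed.

Lemma le_exponent p h K T :
  (forall t, T <= t -> t `^ p <= K * t `^ h) -> p <= h.
Proof.
move=> pK; rewrite leNgt; apply/negP => hp.
have [t [Tt t1 Kt]] := powR_unbounded (p - h) K T ltac:(lra).
have t0 : 0 < t by lra.
have := pK t Tt; rewrite -{1}(subrK h p) powRD; last by rewrite (gt_eqF t0) implybT.
by rewrite ler_pM2r ?powR_gt0// leNgt Kt.
Qed.

(** This reads off an exponent. Comparing the lower bound of each pair with the upper bound of the
    other gives [p <= h] and [h <= p]. *)
Lemma eq_exponent p h c1 c2 C1 C2 T : 0 < c1 -> 0 < C1 ->
  (forall t, T <= t -> exists x,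
    c1 * t `^ p <= x <= c2 * t `^ p /\ C1 * t `^ h <= x <= C2 * t `^ h) ->
  p = h.
Proof.
move=> c0 C0 H; apply/eqP; rewrite eq_le; apply/andP; split.
  apply: (@le_exponent _ _ (C2 / c1) T) => t /H [x [/andP[x1 _] /andP[_ x2]]].
  by rewrite mulrAC ler_pdivlMr// mulrC (le_trans x1).
apply: (@le_exponent _ _ (c2 / C1) T) => t /H [x [/andP[_ x1] /andP[x2 _]]].
by rewrite mulrAC ler_pdivlMr// mulrC (le_trans x2).
Qed.

Lemma is_derive_powR_sub (c al x : R) : x < c ->
  is_derive x 1 (fun y => (c - y) `^ al) (- (al * (c - x) `^ (al - 1))).
Proof.
move=> xc; have cx : 0 < c - x by lra.
have h1 := is_derive1_powR al cx.
have h2 : is_derive x 1 (fun y : R => c - y) (- 1).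
  by rewrite -[- 1]add0r; exact: is_deriveB (is_derive_cst c x 1) (is_derive_id x 1).
rewrite -[- (al * _)]mulrN1.
exact: (@is_derive1_comp _ (fun y => y `^ al) (fun y => c - y)).
Qed.

Lemma continuous_powR_sub (c al x : R) : x < c ->
  {for x, continuous (fun y : R => (c - y) `^ al)}.
Proof.
move=> xc; have [dx _] := is_derive_powR_sub c al x xc.
exact: derivable_continuous.
Qed.

End PowerEstimates.

Section RintegralItv.
Variable R : realType.
Local Notation mu := (@lebesgue_measure R).
Implicit Types (f F g : R -> R) (a b c : R).

Lemma continuous_itv_integrable f a b :
  (forall x, a <= x <= b -> {for x, continuous f}) ->
  mu.-integrable `[a, b] (EFin \o f).
Proof.
move=> cf; apply: continuous_compact_integrable; first exact: segment_compact.
by apply: continuous_in_subspaceT => x /set_mem; rewrite /= in_itv/=; exact: cf.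
Qed.

Lemma is_derive_FTC2 f F a b : a < b ->
  (forall x, a <= x <= b -> is_derive x 1 F (f x)) ->
  (forall x, a <= x <= b -> {for x, continuous f}) ->
  \int[mu]_(x in `[a, b]) f x = F b - F a.
Proof.
move=> ab dF cf; rewrite /Rintegral (@continuous_FTC2 _ f F)//.
- by apply: continuous_in_subspaceT => x /set_mem; rewrite /= in_itv/=; exact: cf.
- have cF x : a <= x <= b -> F y @[y --> x] --> F x.
    move=> /dF[dx _]; exact: derivable_continuous.
  split.
  + by move=> x /subset_itv_oo_cc; rewrite in_itv/= => /dF[].
  + by apply: cvg_at_right_filter; apply: cF; rewrite lexx ltW.
  + by apply: cvg_at_left_filter; apply: cF; rewrite lexx ltW.
- move=> x /subset_itv_oo_cc; rewrite in_itv/= => /dF[_ <-].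
  by rewrite derive1E.
Qed.

Lemma Rintegral_itv_cst a b c : a <= b ->
  \int[mu]_(x in `[a, b]) c = c * (b - a).
Proof.
move=> ab; rewrite Rintegral_cst//= lebesgue_measure_itv/= lte_fin.
by move: ab; rewrite le_eqVlt => /predU1P[->|->//]; rewrite ltxx subrr.
Qed.

Lemma cst_integrable a b c : mu.-integrable `[a, b] (EFin \o cst c).
Proof. by apply: continuous_itv_integrable => x _; exact: cst_continuous. Qed.

Lemma Rintegral_itv_ge f a b c : a <= b -> mu.-integrable `[a, b] (EFin \o f) ->
  (forall x, a <= x <= b -> c <= f x) ->
  c * (b - a) <= \int[mu]_(x in `[a, b]) f x.
Proof.
move=> ab fi cf; rewrite -Rintegral_itv_cst//; apply: le_Rintegral => //.
exact: cst_integrable.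
Qed.

Lemma Rintegral_itv_le f a b c : a <= b -> mu.-integrable `[a, b] (EFin \o f) ->
  (forall x, a <= x <= b -> f x <= c) ->
  \int[mu]_(x in `[a, b]) f x <= c * (b - a).
Proof.
move=> ab fi cf; rewrite -Rintegral_itv_cst//; apply: le_Rintegral => //.
exact: cst_integrable.
Qed.

Lemma ge0_Rintegral_itv_subset f a b c e : a <= c -> e <= b ->
  mu.-integrable `[a, b] (EFin \o f) ->
  (forall x, a <= x <= b -> 0 <= f x) ->
  \int[mu]_(x in `[c, e]) f x <= \int[mu]_(x in `[a, b]) f x.
Proof.
move=> ac eb fi f0.
have sub : [set` `[c, e]] `<=` [set` `[a, b]].
  by move=> x /=; rewrite !in_itv/= => /andP[]; lra.
apply: fine_le.
- apply: integrable_fin_num => //; exact: integrableS fi.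
- exact: integrable_fin_num.
- apply: ge0_subset_integral => //; first exact: measurable_int fi.
Qed.

Lemma Rintegral_supported f a b : (forall x, f x != 0 -> a <= x <= b) ->
  \int[mu]_x f x = \int[mu]_(x in `[a, b]) f x.
Proof.
move=> fab; rewrite [RHS]Rintegral_mkcond; congr (Rintegral _ _ _).
apply/funext => x; rewrite patchE; case: ifPn => //.
rewrite notin_setE /= in_itv /= => xab; apply/eqP; apply: contra_notT xab.
exact: fab.
Qed.

End RintegralItv.

(** * Test functions *)

Section SupportedTestFunctions.
Variables (R : realType).
Local Notation mu := (@lebesgue_measure R).

Lemma continuous_itv_bounded (f : R -> R) a b : a <= b ->
  (forall x, a <= x <= b -> {for x, continuous f}) ->
  exists2 M, 0 < M & forall x, a <= x <= b -> `|f x| <= M.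
Proof.
move=> ab cf.
have cn : {within `[a, b], continuous (fun x => `|f x|)}.
  apply: continuous_in_subspaceT => x /set_mem; rewrite /= in_itv/= => xab.
  by apply: cvg_norm; exact: cf.
have [c _ cP] := EVT_max ab cn.
exists (`|f c| + 1) => [|x xab]; first by rewrite ltr_wpDl.
by rewrite (@le_trans _ _ `|f c|) ?cP ?in_itv// lerDl.
Qed.

(** A monotone [N] is measurable and stays between its end values on [[a, b]], so it is a bounded
    factor of an integrable function. *)
Lemma nonincreasing_mul_integrable (N g : R -> R) a b :
  {homo N : x y /~ x <= y} ->
  (forall x, a <= x <= b -> {for x, continuous g}) ->
  mu.-integrable `[a, b] (EFin \o (fun x => N x * g x)).
Proof.
move=> Nni cg.
apply: (@integrableMr _ _ _ mu _ _ N (EFin \o g)) => //.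
- by apply: nonincreasing_measurable => // x y; exact: Nni.
- exists (Num.max `|N a| `|N b|); split; first exact: num_real.
  move=> M MN x /=; rewrite in_itv/= => /andP[ax xb].
  apply: le_trans (ltW MN); rewrite ler_norml le_max.
  have := Nni _ _ ax; have := Nni _ _ xb.
  rewrite lerNl le_max.
  have := ler_norm (N a); have := ler_norm (- N b); rewrite normrN => *.
  by apply/andP; split; apply/orP; [right|left]; lra.
- exact: continuous_itv_integrable.
Qed.

Lemma is_derive_scale (phi : R -> R) L x : derivable phi (x / L) 1 ->
  is_derive x 1 (fun y => phi (y / L)) (derive1 phi (x / L) / L).
Proof.
move=> dphi.
have h1 : is_derive (x / L) 1 phi (derive1 phi (x / L)).
  by rewrite derive1E; exact: derivableP.
have h2 : is_derive x 1 (fun y : R => y / L) (L^-1).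
  have := is_deriveZ (L^-1) (is_derive_id x (1 : R)).
  rewrite (_ : L^-1 \*: id = (fun y => y / L)) ?[_ *: 1]mulr1//.
  by apply/funext => y; rewrite /= mulrC.
exact: (@is_derive1_comp _ phi (fun y => y / L)).
Qed.

(** The strict inequalities make [phi] vanish at [a] and [b], which kills the boundary terms of the
    later integration by parts. Outside [[a, b]] the function is locally zero, hence so is its
    derivative. *)
Lemma test_function_support (phi : R -> R) : test_function phi ->
  (exists2 b, b < 0 & forall x, phi x != 0 -> x <= b) ->
  exists a b, [/\ a < b, b < 0, forall x, phi x != 0 -> a < x < b &
    forall x, derive1 phi x != 0 -> a <= x <= b].
Proof.
move=> [_ [a0 [b0 ab0]]] [b1 b10 b1P].
pose b := b1 / 2; pose a := Num.min a0 b - 1.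
have a0P : a <= a0 - 1 by rewrite lerD2r ge_min lexx.
have abP : a <= b - 1 by rewrite lerD2r ge_min lexx orbT.
have bE : b = b1 / 2 by [].
have supp x : phi x != 0 -> a < x < b.
  by move=> x0; have /andP[? ?] := ab0 _ x0; have := b1P _ x0; lra.
exists a, b; split=> //; try lra.
move=> x; apply: contraNT; rewrite negb_and -!ltNge => xab.
rewrite derive1E (@near_eq_derive _ _ _ phi (cst 0) x 1) ?derive_cst//.
case/orP: xab => xab.
  have : \forall y \near x, y < a by exact: lt_nbhsl.
  apply: filterS => y ya; apply/eqP; apply: contraLR ya => /supp /andP[].
  by rewrite -leNgt => /ltW.
have : \forall y \near x, b < y by exact: lt_nbhsr.
apply: filterS => y ya; apply/eqP; apply: contraLR ya => /supp /andP[].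
by rewrite -leNgt => _ /ltW.
Qed.

(** The rescaled support has length of order [L], and [pi - x] is of order [L] on it, which gives
    order [L ^ (al + 1)]. The lower bound keeps only a neighbourhood of [x0] where [phi] is at least
    half of [phi x0]. *)
Lemma weight_bounds (phi : R -> R) (B al : R) : 0 < B ->
  test_function phi -> (forall x, 0 <= phi x) -> (exists x, phi x != 0) ->
  (exists2 b, b < 0 & forall x, phi x != 0 -> x <= b) ->
  exists c1 c2, [/\ 0 < c1, 0 < c2 & forall L, 1 <= L ->
    c1 * L `^ (al + 1) <= \int[mu]_x (B * (pi - x) `^ al * phi (x / L))
      <= c2 * L `^ (al + 1)].
Proof.
move=> B0 tphi phi0 [x0 phix0] sb.
have [a [b [ab b0 supp _]]] := test_function_support phi tphi sb.
have cphi x : {for x, continuous phi}.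
  by apply: derivable_continuous; exact: (tphi.1 0%N x).
have [M M0 MP] := @continuous_itv_bounded phi a b (ltW ab) (fun x _ => cphi x).
have p0 : 0 < phi x0 by rewrite lt_neqAle eq_sym phix0 phi0.
have [r r0 rP] : exists2 r, 0 < r &
    forall x, x0 - r <= x <= x0 + r -> phi x0 / 2 <= phi x.
  have p2 : 0 < phi x0 / 2 by rewrite divr_gt0.
  have /cvgrPdist_lt /(_ _ p2) := cphi x0.
  move=> /nbhs_ballP[r /= r0 rP]; exists (r / 2) => [|x xr]; first exact: divr_gt0.
  have : `|phi x0 - phi x| < phi x0 / 2.
    by apply: rP; rewrite /ball/= ltr_norml; lra.
  by rewrite ltr_norml; lra.
have ppi : 0 < pi :> R by exact: pi_gt0.
(* For [x] in [[a * L, b * L]] and [L >= 1], the inequalities [0 < pi <= pi * L] place [pi - x]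
   between [- b * L] and [(pi - a) * L]. *)
have /= [k1 [k2 [k10 k20 kP]]] := powR_bounds R al (- b) (pi - a) ltac:(lra) ltac:(lra).
have x0a : a < x0 - r.
  have /supp/andP[] // : phi (x0 - r) != 0.
  by rewrite gt_eqF// (lt_le_trans _ (rP _ _))//; lra.
have x0b : x0 + r < b.
  have /supp/andP[] // : phi (x0 + r) != 0.
  by rewrite gt_eqF// (lt_le_trans _ (rP _ _))//; lra.
exists (B * k1 * (phi x0 / 2) * (2 * r)), (B * k2 * M * (b - a)).
split; rewrite ?mulr_gt0// ?subr_gt0// => L L1.
have L0 : 0 < L by lra.
pose g x := B * (pi - x) `^ al * phi (x / L).
have scl x : (a * L <= x <= b * L) = (a <= x / L <= b).
  by rewrite ler_pdivrMr// ler_pdivlMr.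
have pib x : a * L <= x <= b * L -> k1 * L `^ al <= (pi - x) `^ al <= k2 * L `^ al.
  move=> xL; apply: kP => //; nra.
have bL : b * L < 0 by nra.
have gi : mu.-integrable `[a * L, b * L] (EFin \o g).
  apply: continuous_itv_integrable => x xL.
  have [dx _] := is_derive_scale phi L x (tphi.1 0%N (x / L)).
  apply: continuousM; last exact: derivable_continuous.
  apply: continuousM; first exact: cvg_cst.
  by apply: continuous_powR_sub; lra.
have g0 x : a * L <= x <= b * L -> 0 <= g x.
  by move=> _; rewrite !mulr_ge0// ?powR_ge0// ltW.
rewrite (@Rintegral_supported _ _ (a * L) (b * L)); last first.
  move=> x; rewrite mulf_eq0 negb_or => /andP[_ /supp/andP[h1 h2]].
  by rewrite scl !ltW.
have Lal : L `^ (al + 1) = L `^ al * L.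
  by rewrite powRD ?powRr1 ?(ltW L0)// (gt_eqF L0) implybT.
have La0 : 0 < L `^ al by rewrite powR_gt0.
apply/andP; split.
- have sub : \int[mu]_(x in `[(x0 - r) * L, (x0 + r) * L]) g x <=
     \int[mu]_(x in `[a * L, b * L]) g x.
    apply: ge0_Rintegral_itv_subset => //; nra.
  apply: le_trans sub.
  apply: (@le_trans _ _ ((B * (k1 * L `^ al) * (phi x0 / 2)) *
      ((x0 + r) * L - (x0 - r) * L))).
    by rewrite Lal le_eqVlt; apply/orP; left; apply/eqP; ring.
  apply: Rintegral_itv_ge; first nra.
    apply: integrableS gi => // x /=; rewrite !in_itv/=; nra.
  move=> x xr.
  have xab : a * L <= x <= b * L by nra.
  have /andP[h1 _] := pib x xab.
  have h2 : phi x0 / 2 <= phi (x / L).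
    by apply: rP; rewrite ler_pdivrMr// ler_pdivlMr.
  apply: ler_pM => //; last by rewrite ler_pM2l.
  - by rewrite !mulr_ge0 ?(ltW B0) ?(ltW k10) ?(ltW La0).
  - by rewrite divr_ge0.
- apply: (@le_trans _ _ ((B * (k2 * L `^ al) * M) * (b * L - a * L))); last first.
    by rewrite Lal le_eqVlt; apply/orP; left; apply/eqP; ring.
  apply: Rintegral_itv_le => //; first nra.
  move=> x xab; have /andP[_ h1] := pib x xab.
  have h2 : phi (x / L) <= M.
    by apply: le_trans (ler_norm _) (MP _ _); rewrite -scl.
  apply: ler_pM => //; rewrite ?mulr_ge0// ?powR_ge0// ?(ltW B0)// ?ler_pM2l//.
Qed.

End SupportedTestFunctions.

(** * From the counting function to its derivative *)

Section Transfer.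
Variables (R : realType) (N : R -> R) (A h : R).
Local Notation mu := (@lebesgue_measure R).
Hypotheses (A0 : 0 < A) (h0 : 0 < h).
Hypothesis NA : N ~_(-oo) (fun C : R => A * (pi - C) `^ h).
Let dens (C : R) := h * A * (pi - C) `^ (h - 1).
Let F (C : R) := A * (pi - C) `^ h.

Lemma is_derive_prim x : x < pi -> is_derive x 1 F (- dens x).
Proof.
move=> xpi.
have := is_deriveZ A (is_derive_powR_sub _ pi h x xpi).
rewrite /GRing.scale/= /dens.
have -> : A * - (h * (pi - x) `^ (h - 1)) = - (h * A * (pi - x) `^ (h - 1)) by ring.
by [].
Qed.

Lemma dens_continuous x : x < pi -> {for x, continuous dens}.
Proof.
move=> xpi; apply: continuousM; first exact: cvg_cst.
exact: continuous_powR_sub.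
Qed.

(** Since [A] and [h] are positive, [F] tends to infinity at [-oo] and dominates any constant. Half
    of [e] is spent on [f] and half on [c]. *)
Lemma equiv_subr_cst (f : R -> R) (c : R) :
  f ~_(-oo) F -> (fun C => f C - c) ~_(-oo) F.
Proof.
move=> /equiv_ninftyP fF; apply/equiv_ninftyP => e e0.
have e20 : 0 < e / 2 by rewrite divr_gt0.
have [T TP] := fF _ e20.
have [t [t1 _ t2]] :=
  powR_unbounded R h (`|c| / (A * (e / 2))) (Num.max (pi - T) 0) h0.
exists (pi - t) => C Ct.
move: t1; rewrite ge_max => /andP[t1 t0].
have tC : t `^ h <= (pi - C) `^ h.
  by apply: ge0_ler_powR; rewrite ?nnegrE ?(ltW h0)//; lra.
have Ae : 0 < A * (e / 2) by rewrite mulr_gt0.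
have cF : `|c| <= e / 2 * `|F C|.
  rewrite (@ger0_norm _ (F C)) ?mulr_ge0 ?powR_ge0 ?(ltW A0)//.
  move: t2; rewrite ltr_pdivrMr// => t2; apply: le_trans (ltW t2) _.
  rewrite (_ : e / 2 * F C = (pi - C) `^ h * (A * (e / 2))) ?ler_pM2r//.
  by rewrite /F; ring.
have := TP C ltac:(lra); rewrite addrAC => fC.
by apply: le_trans (ler_normB _ _) _; lra.
Qed.

Lemma Rintegral_dens C C0 : C < C0 -> C0 < pi ->
  \int[mu]_(x in `[C, C0]) dens x = F C - F C0.
Proof.
move=> CC0 C0pi; transitivity ((- F) C0 - (- F) C); last by rewrite !fctE; ring.
apply: is_derive_FTC2 => //.
- move=> x xC; rewrite -[dens x]opprK; apply: is_deriveN.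
  by apply: is_derive_prim; lra.
- by move=> x xC; apply: dens_continuous; lra.
Qed.

(** The two masses are increments of [N] and of [F]; the subtracted values at [C0] are negligible on
    both sides. *)
Lemma stieltjes_equiv_density : stieltjes_equiv N dens.
Proof.
move=> C0 C0pi; apply: equiv_trans (equiv_subr_cst _ (N C0) NA) _.
apply: equiv_sym; apply/equiv_ninftyP => e e0.
have /equiv_ninftyP/(_ _ e0)[T TP] := equiv_subr_cst _ (F C0) (equiv_refl _ F).
exists (Num.min T (C0 - 1)) => C; rewrite le_min => /andP[CT CC0].
by rewrite Rintegral_dens//; [exact: TP|lra].
Qed.

Hypothesis Nni : {homo N : x y /~ x <= y}.

Lemma distr_equiv_density : distr_equiv (neg_distr_derivative N) dens.
Proof.
move=> phi tphi phi0 phin0 sb; apply/equiv_pinftyP => e e0.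
have [c1 [c2 [c10 _ cP]]] :=
  weight_bounds R phi (h * A) (h - 1) (mulr_gt0 h0 A0) tphi phi0 phin0 sb.
have [a [b [ab b0 supp supp']]] := test_function_support R phi tphi sb.
have dphi x : derivable phi x 1 by exact: (tphi.1 0%N x).
have dphi' x : derivable (derive1 phi) x 1 by exact: (tphi.1 1%N x).
have [|M M0 MP] := @continuous_itv_bounded R (derive1 phi) a b (ltW ab).
  by move=> x _; exact: derivable_continuous.
have ppi : 0 < pi :> R by exact: pi_gt0.
(* On the rescaled support, [F] is at most [A * (pi - a) ^ h * L ^ h], the derivative of [psi] at
   most [M / L], and the length is [(b - a) * L]. A relative error [e * c1 / K] for [N] thus costs
   at most [e * c1 * L ^ h]. *)
pose K := A * (pi - a) `^ h * M * (b - a).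
have K0 : 0 < K by rewrite !mulr_gt0 ?powR_gt0//; lra.
have ec0 : 0 < e * c1 / K by rewrite divr_gt0// mulr_gt0.
have /equiv_ninftyP/(_ _ ec0)[T TP] := NA.
(* As [b] is negative, [L >= T / b] means [b * L <= T]: the whole rescaled support lies where [N] is
   close to [F]. *)
exists (Num.max 1 (T / b)) => L; rewrite ge_max => /andP[L1 LT].
have L0 : 0 < L by lra.
have LbT : b * L <= T by move: LT; rewrite ler_ndivrMr// mulrC.
have bL : b * L < 0 by nra.
have abL : a * L < b * L by nra.
pose psi (x : R) := phi (x / L).
have dpsi (x : R) : is_derive x 1 psi (derive1 phi (x / L) / L).
  exact: is_derive_scale.
have psi'E : derive1 psi = fun x => derive1 phi (x / L) / L.
  by apply/funext => x; rewrite derive1E; have [_ ->] := dpsi x.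
have cpsi x : {for x, continuous psi}.
  by apply: derivable_continuous; case: (dpsi x).
have cpsi' x : {for x, continuous (derive1 psi)}.
  rewrite psi'E; apply: continuousM; last exact: cvg_cst.
  apply: derivable_continuous.
  by case: (is_derive_scale R (derive1 phi) L x (dphi' (x / L))).
have scl x : (a * L <= x <= b * L) = (a <= x / L <= b).
  by rewrite ler_pdivrMr// ler_pdivlMr.
have -> : neg_distr_derivative N psi =
    \int[mu]_(x in `[a * L, b * L]) (N x * derive1 psi x).
  apply: Rintegral_supported => x; rewrite psi'E scl !mulf_eq0 !negb_or.
  by move=> /and3P[_ /supp'].
have := cP L L1; rewrite subrK => /andP[lo _].
rewrite (ger0_norm (le_trans _ lo)) ?mulr_ge0 ?powR_ge0 ?(ltW c10)//.
apply: (@le_trans _ _ (e * c1 * L `^ h)); last by rewrite -mulrA ler_pM2l.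
have -> : \int[mu]_x (h * A * (pi - x) `^ (h - 1) * phi (x / L)) =
    \int[mu]_(x in `[a * L, b * L]) (dens x * psi x).
  apply: Rintegral_supported => x; rewrite mulf_eq0 negb_or.
  by move=> /andP[_ /supp/andP[? ?]]; rewrite scl !ltW.
have iN : mu.-integrable `[a * L, b * L] (EFin \o (fun x => N x * derive1 psi x)).
  exact: nonincreasing_mul_integrable.
have cF x : a * L <= x <= b * L -> {for x, continuous F}.
  move=> xL; apply: derivable_continuous.
  by have [] : is_derive x 1 F (- dens x) by apply: is_derive_prim; lra.
have cd x : a * L <= x <= b * L -> {for x, continuous dens}.
  by move=> xL; apply: dens_continuous; lra.
have iF : mu.-integrable `[a * L, b * L] (EFin \o (fun x => F x * derive1 psi x)).
  apply: continuous_itv_integrable => x xL; apply: continuousM; last exact: cpsi'.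
  exact: cF.
have idens : mu.-integrable `[a * L, b * L] (EFin \o (fun x => dens x * psi x)).
  apply: continuous_itv_integrable => x xL; apply: continuousM; last exact: cpsi.
  exact: cd.
have psi_end (x : R) : (x == a * L) || (x == b * L) -> psi x = 0.
  move=> xE; apply/eqP; apply: contraT => /supp.
  by case/orP: xE => /eqP ->; rewrite mulfK ?gt_eqF// ltxx ?andbF.
(* The difference of the integrands is the derivative of [F * psi], which vanishes at both ends. *)
have byparts : \int[mu]_(x in `[a * L, b * L]) (F x * derive1 psi x) =
    \int[mu]_(x in `[a * L, b * L]) (dens x * psi x).
  apply/eqP; rewrite -subr_eq0 -RintegralB//; apply/eqP.
  transitivity ((F * psi) (b * L) - (F * psi) (a * L)); last first.
    by rewrite !fctE !psi_end ?eqxx ?orbT// !mulr0 subrr.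
  apply: is_derive_FTC2 => //.
  - move=> x xL.
    have := is_deriveM (is_derive_prim x ltac:(lra)) (dpsi x).
    rewrite /GRing.scale/= psi'E; congr is_derive; ring.
  - move=> x xL; apply: continuousB; apply: continuousM => //; [exact: cF|exact: cd].
rewrite -byparts -RintegralB//.
under eq_Rintegral do rewrite -mulrBl.
have iNF : mu.-integrable `[a * L, b * L]
    (EFin \o (fun x => (N x - F x) * derive1 psi x)).
  rewrite (_ : _ \o _ = ((EFin \o (fun x => N x * derive1 psi x)%R) \-
    (EFin \o (fun x => F x * derive1 psi x)%R))%E).
    exact: integrableB.
  by apply/funext => x /=; rewrite -EFinB mulrBl.
apply: (le_trans (le_normr_Rintegral _ iNF)) => //.
have bnd : e * c1 * L `^ h =
   (e * c1 / K * (A * ((pi - a) `^ h * L `^ h)) * (M / L)) * (b * L - a * L).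
  rewrite /K; field; rewrite !gt_eqF ?powR_gt0//; lra.
rewrite bnd; apply: Rintegral_itv_le; first exact: ltW.
  by have := integrable_norm iNF.
move=> x xL; rewrite normrM; apply: ler_pM => //.
- apply: le_trans (TP x ltac:(lra)) _; rewrite ler_pM2l//.
  rewrite ger0_norm ?mulr_ge0 ?powR_ge0 ?(ltW A0)// ler_pM2l//.
  rewrite -powRM ?(ltW L0)//; last lra.
  apply: ge0_ler_powR; rewrite ?nnegrE ?(ltW h0)//; nra.
- rewrite psi'E normrM (ger0_norm (_ : 0 <= L^-1)) ?invr_ge0 ?(ltW L0)//.
  by rewrite ler_pM2r ?invr_gt0// MP// -scl.
Qed.

End Transfer.

(** * A smooth bump *)

Section Bump.
Variables (R : realType) (q : {poly R}).
Implicit Types (P : {poly R}) (x : R).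

(* This family is closed under differentiation, hence consists of smooth
   functions; the exponential makes it O(q^2) near the zeros of q. *)
Definition flat P k x : R :=
  if 0 < q.[x] then P.[x] * q.[x]^-1 ^+ k.+1 * expR (- q.[x]^-1) else 0.

(** The numerator obtained when the derivative of [P * q^-(k+1) * exp(-1/q)] is put over the common
    denominator [q^(k+3)]. *)
Definition flat_deriv P k : {poly R} :=
  P^`() * q ^+ 2 - k.+1%:R *: (P * q^`() * q) + P * q^`().

(** With [w = 1/q], a single term of the exponential series gives [exp w >= w^(k+3) / (k+3)!], hence
    [w^(k+1) * exp(-w) <= (k+3)! * q^2]. *)
Lemma flat_le P k x : `|flat P k x| <= k.+3`!%:R * `|P.[x]| * q.[x] ^+ 2.
Proof.
rewrite /flat; case: ifPn => [q0|_]; last first.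
  by rewrite normr0 mulr_ge0 ?sqr_ge0// mulr_ge0.
set w := q.[x]^-1; have w0 : 0 < w by rewrite invr_gt0.
have f0 : 0 < k.+3`!%:R :> R by rewrite ltr0n fact_gt0.
rewrite !normrM (ger0_norm (expR_ge0 _)) (ger0_norm (exprn_ge0 _ (ltW w0))).
rewrite -!mulrA [leRHS]mulrCA; apply: ler_wpM2l => //.
have ew : w ^+ k.+3 / k.+3`!%:R <= expR w.
  by apply: le_trans (expR_ge1Dxn k.+2 (ltW w0)); rewrite lerDr.
rewrite expRN ler_pdivrMr ?expR_gt0//.
have -> : w ^+ k.+1 = q.[x] ^+ 2 * w ^+ k.+3.
  rewrite 2![w ^+ _.+2]exprS (_ : _ * _ = (q.[x] * w) ^+ 2 * w ^+ k.+1); last ring.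
  by rewrite mulfV ?gt_eqF// expr1n mul1r.
rewrite [leRHS](_ : _ = q.[x] ^+ 2 * (k.+3`!%:R * expR w)); last ring.
rewrite ler_pM2l ?exprn_gt0//.
by move: ew; rewrite ler_pdivrMr// mulrC.
Qed.

Lemma is_derive_flat P k x :
  is_derive x 1 (flat P k) (flat (flat_deriv P k) k.+2 x).
Proof.
have cq : q.[y] @[y --> x] --> q.[x] by exact: continuous_horner.
have [q0|q0|q0] := ltgtP q.[x] 0.
- have -> : flat (flat_deriv P k) k.+2 x = 0 by rewrite /flat ltNge (ltW q0).
  apply: (@near_eq_is_derive _ _ _ (cst 0)).
  have : \forall y \near x, q.[y] < 0 by exact: cvgr_lt cq _ q0.
  apply: filterS => y /= qy.
  by rewrite /flat ltNge (ltW qy).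
- pose f y := P.[y] * q.[y]^-1 ^+ k.+1 * expR (- q.[y]^-1).
  apply: (@near_eq_is_derive _ _ _ f).
    have : \forall y \near x, 0 < q.[y] by exact: cvgr_gt cq _ q0.
    apply: filterS => y /= qy.
    by rewrite /flat qy.
  have dw := is_deriveV (lt0r_neq0 q0) (is_derive_poly q x).
  have dE := @is_derive1_comp _ expR _ _ _ _ (is_derive_expR _) (is_deriveN dw).
  have := is_deriveM (is_deriveM (is_derive_poly P x) (is_deriveX k.+1 dw)) dE.
  rewrite (_ : _ * _ * _ = f); last first.
    by apply/funext => y; rewrite /f /= !fctE.
  have -> : flat (flat_deriv P k) k.+2 x =
    (P^`().[x] * q.[x] ^+ 2 - k.+1%:R * (P.[x] * q^`().[x] * q.[x]) +
     P.[x] * q^`().[x]) * (q.[x]^-1 ^+ 3 * q.[x]^-1 ^+ k) * expR (- q.[x]^-1).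
    rewrite /flat q0 -exprD /flat_deriv.
    by rewrite !(hornerD, hornerN, hornerZ, hornerM, horner_exp).
  move=> /is_derive_eq; apply; rewrite !fctE exprS -[k.+1.-1]/k.
  set X := q.[x]^-1 ^+ k; set c := k.+1%:R; rewrite /GRing.scale/=.
  field; exact: lt0r_neq0.
- have -> : flat (flat_deriv P k) k.+2 x = 0 by rewrite /flat q0 ltxx.
  have fx : flat P k x = 0 by rewrite /flat q0 ltxx.
  (* At a zero of [q] the slope function must be continuous with value 0, which is what division by
     zero returns at [z = x]. *)
  apply/is_derive1_caratheodory; exists (fun z => flat P k z / (z - x)).
  split; last by rewrite fx mul0r.
    move=> z; rewrite fx subr0; have [->|zx] := eqVneq z x.
      by rewrite fx mul0r mul0r.
    by rewrite divfK// subr_eq0.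
  have [r qr] := factor_theorem _ _ (introT eqP q0 : root q x).
  (* Writing [q = r * (X - x)] turns the quadratic bound on [flat], divided by [z - x], into this
     polynomial, which vanishes at [x] and squeezes the slope. *)
  pose b := k.+3`!%:R *: (P * r ^+ 2 * ('X - x%:P)).
  have bc : `|b.[z]| @[z --> x] --> (0 : R).
    have bx : b.[x] = 0 by rewrite /b !(hornerZ, hornerM, hornerXsubC) subrr !mulr0.
    have := cvg_norm (@continuous_horner _ b x); rewrite bx normr0; exact.
  rewrite /prop_for /continuous_at fx mul0r.
  apply: (@squeeze_cvgr _ _ _ _ (fun z => - `|b.[z]|) (fun z => `|b.[z]|)).
  + apply: nearW => z; rewrite -ler_norml.
    have [->|zx] := eqVneq z x; first by rewrite fx mul0r normr0.
    have zx0 : 0 < `|z - x| by rewrite normr_gt0 subr_eq0.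
    rewrite normrM normfV ler_pdivrMr//; apply: le_trans (flat_le P k z) _.
    have E : b.[z] * (z - x) = k.+3`!%:R * P.[z] * q.[z] ^+ 2.
      by rewrite /b qr !(hornerZ, hornerM, horner_exp, hornerXsubC); ring.
    by rewrite -normrM E normrM (ger0_norm (sqr_ge0 _)) normrM normr_nat.
  + by rewrite -[X in _ --> X]oppr0; exact: (cvgN bc).
  + by [].
Qed.

Lemma derive1n_flat P k n : exists P' k', derive1n n (flat P k) = flat P' k'.
Proof.
elim: n => [|n [P' [k' IH]]]; first by exists P, k.
exists (flat_deriv P' k'), k'.+2; rewrite derive1nS IH; apply/funext => x.
by rewrite derive1E; have [_ ->] := is_derive_flat P' k' x.
Qed.

End Bump.

(** The bump is [exp(-1/q) / q] where [q = -(x+2)(x+1)] is positive, that is on []-2, -1[], and 0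
    elsewhere. It gives content to a distributional hypothesis, which only speaks about test
    functions. *)
Lemma exists_bump (R : realType) : exists phi : R -> R,
  [/\ test_function phi, forall x, 0 <= phi x, exists x, phi x != 0 &
    exists2 b, b < 0 & forall x, phi x != 0 -> x <= b].
Proof.
pose q : {poly R} := - (('X + 2%:P) * ('X + 1%:P)).
have qE x : q.[x] = - ((x + 2) * (x + 1)) by rewrite /q !hornerE.
have supp x : flat R q 1 0 x != 0 -> -2 <= x <= -1.
  rewrite /flat qE; case: ifPn => [q0 _|]; last by rewrite eqxx.
  by apply/andP; split; nra.
exists (flat R q 1 0); split.
- split; last by exists (-2), (-1).
  move=> n x; have [P [k ->]] := derive1n_flat R q 1 0 n.
  by have [] := is_derive_flat R q P k x.
- move=> x; rewrite /flat; case: ifPn => // q0.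
  rewrite -polyC1 hornerC mul1r mulr_ge0 ?expR_ge0//.
  by rewrite exprn_ge0// invr_ge0 ltW.
- exists (- 3 / 2); rewrite /flat.
  have q0 : 0 < q.[-3 / 2] by rewrite qE; lra.
  rewrite q0 -polyC1 hornerC mul1r gt_eqF// mulr_gt0 ?expR_gt0//.
  by rewrite exprn_gt0// invr_gt0.
- by exists (-1); [lra|move=> x /supp/andP[]].
Qed.

(** * The exponent is determined *)

Section Exponent.
Variables (R : realType) (A h B al : R).
Hypotheses (A0 : 0 < A) (h0 : 0 < h) (B0 : 0 < B).
Local Notation mu := (@lebesgue_measure R).

(** The integral over [[C, 0]] need not grow like [(pi - C) ^ (al + 1)]: it may be logarithmic or
    bounded. The block [[pi - 2t, pi - t]] has exact order [al + 1] for every [al], and its mass is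
    also close to [A * (2 ^ h - 1) * t ^ h]. *)
Lemma stieltjes_exponent (N : R -> R) :
  N ~_(-oo) (fun C : R => A * (pi - C) `^ h) ->
  stieltjes_equiv N (fun C => B * (pi - C) `^ al) -> al + 1 = h.
Proof.
move=> NA SN; have ppi : 0 < pi :> R by exact: pi_gt0.
pose w (x : R) := B * (pi - x) `^ al.
pose X (t : R) := \int[mu]_(x in `[pi - t, 0]) w x.
have XF : (fun C => \int[mu]_(x in `[C, 0]) w x) ~_(-oo)
    (fun C : R => A * (pi - C) `^ h).
  by apply: equiv_trans (equiv_sym (SN 0 ppi)) (equiv_subr_cst _ _ _ A0 h0 _ _ NA).
have h2 : 1 < 2 `^ h :> R.
  by have := gt0_ltr_powR h0 (_ : 1 \is Num.nneg) (_ : 2 \is Num.nneg) (ltr1n R 2);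
    rewrite /= powR1; apply; rewrite nnegrE.
set p : R := 2 `^ h in h2.
(* The errors at [2 * t] and [t] add up to [e * (1 + p) * A * t ^ h], which this [e] makes half of
   the main term [A * (p - 1) * t ^ h]; hence the factors 1/2 and 3/2 below. *)
pose e := (p - 1) / (2 * (1 + p)).
have p0 : 1 + p != 0 by rewrite gt_eqF//; lra.
have e0 : 0 < e by rewrite divr_gt0 ?mulr_gt0//; lra.
have eE : e * (1 + p) = (p - 1) / 2 by rewrite /e; field.
have /equiv_ninftyP/(_ _ e0)[T TP] := XF.
have [k1 [k2 [k10 k20 kP]]] := powR_bounds R al 1 2 ltac:(lra) ltac:(lra).
(* The first bound puts [pi - t] and [pi - 2 * t] below [T]; the second makes both negative, so that
   the integrals up to 0 are properly oriented. *)
pose T0 := Num.max (pi - T) (pi + 1).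
apply: (@eq_exponent R _ _ (B * k1) (B * k2) (A * ((p - 1) / 2))
   (A * (3 * (p - 1) / 2)) T0); first exact: mulr_gt0.
  by rewrite mulr_gt0//; lra.
move=> t; rewrite ge_max => /andP[tT tpi].
have t0 : 0 < t by lra.
exists (X (2 * t) - X t).
have cw x : x < pi -> {for x, continuous w}.
  by move=> xpi; apply: continuousM; [exact: cvg_cst|exact: continuous_powR_sub].
have iw C1 C2 : C2 < pi -> mu.-integrable `[C1, C2] (EFin \o w).
  by move=> C2pi; apply: continuous_itv_integrable => x xC; apply: cw; lra.
split.
  have -> : X (2 * t) - X t = \int[mu]_(x in `[pi - 2 * t, pi - t]) w x.
    have <- : \int[mu]_(x in `]pi - t, 0]) w x = X t.
      apply: Rintegral_itv_obnd_cbnd.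
      apply: integrableS (iw (pi - t) 0 ppi) => // x /=; rewrite !in_itv/=.
      by move=> /andP[/ltW -> ->].
    rewrite -(Rintegral_itvB (iw (pi - 2 * t) 0 ppi)) ?subKr// bnd_simp; lra.
  have tE : t `^ (al + 1) = t `^ al * (pi - t - (pi - 2 * t)).
    rewrite powRD ?powRr1 ?(ltW t0)// ?(gt_eqF t0) ?implybT//.
    by congr (_ * _); ring.
  have wP x : pi - 2 * t <= x <= pi - t ->
      B * (k1 * t `^ al) <= w x <= B * (k2 * t `^ al).
    by move=> xt; rewrite /w !ler_pM2l//; apply: kP => //; lra.
  have mulE k s D : B * k * (s * D) = B * (k * s) * D by ring.
  rewrite tE !mulE; apply/andP; split.
    by apply: Rintegral_itv_ge; [lra|apply: iw; lra|move=> x /wP/andP[]].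
  by apply: Rintegral_itv_le; [lra|apply: iw; lra|move=> x /wP/andP[]].
have := TP (pi - t) ltac:(lra); have := TP (pi - 2 * t) ltac:(lra).
rewrite -/(X t) -/(X (2 * t)) !subKr !(ger0_norm (mulr_ge0 (ltW A0) (powR_ge0 _ _))).
rewrite powRM ?(ltW t0)// !ler_norml.
rewrite -/p; set s := t `^ h => /andP[h21 h22] /andP[h11 h12].
have eEs : A * s * (e * (1 + p)) = A * s * ((p - 1) / 2) by rewrite eE.
by apply/andP; split; lra.
Qed.

(** Tested on one bump, the two densities have equivalent pairings by transitivity through [T], and
    the pairings have exact orders [h] and [al + 1]. *)
Lemma distr_exponent (T : (R -> R) -> R) :
  distr_equiv T (fun C => h * A * (pi - C) `^ (h - 1)) ->
  distr_equiv T (fun C => B * (pi - C) `^ al) -> al + 1 = h.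
Proof.
have [phi [tphi phi0 phin0 sb]] := exists_bump R.
move=> /(_ phi tphi phi0 phin0 sb) Td /(_ phi tphi phi0 phin0 sb) Tw.
have [c1 [c2 [c10 _ cP]]] :=
  weight_bounds R phi (h * A) (h - 1) (mulr_gt0 h0 A0) tphi phi0 phin0 sb.
have [k1 [k2 [k10 _ kP]]] := weight_bounds R phi B al B0 tphi phi0 phin0 sb.
have half0 : 0 < 2^-1 :> R by rewrite invr_gt0.
have /equiv_pinftyP/(_ _ half0)[S SP] := equiv_trans (equiv_sym Tw) Td.
apply: (@eq_exponent R _ _ k1 k2 (c1 / 2) (3 / 2 * c2) (Num.max S 1)) => //.
  by rewrite divr_gt0.
move=> L; rewrite ge_max => /andP[LS L1].
have := SP L LS; have := cP L L1; have := kP L L1; rewrite subrK.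
set I := Rintegral _ _ _; set J := Rintegral _ _ _ => kI /andP[cJ Jc] IJ.
exists I; split=> //.
have J0 : 0 <= J by apply: le_trans cJ; rewrite mulr_ge0 ?powR_ge0 ?ltW.
by move: IJ; rewrite (ger0_norm J0) ler_norml => /andP[? ?]; apply/andP; split; lra.
Qed.

End Exponent.

Theorem theorem7 (R : realType) :
  exists A : nat -> R -> R -> R,
    (forall (d : nat) (eps gamma : R),
       (0 < d)%N -> 0 < eps -> 0 < gamma -> 0 < A d eps gamma) /\
    forall (d : nat) (M : riemannianManifold R d) (lambda : nat -> R)
           (eps gamma : R),
      (0 < d)%N -> laplace_spectrum M lambda -> 0 < eps ->
      0 < gamma -> weyl_asymptotics d gamma lambda ->
      let Ad := A d eps gamma in
      let density := fun C : R =>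
        d%:R / 2 * Ad * (pi - C) `^ ((d%:R - 2) / 2) in
      [/\ N_enc eps lambda ~_(-oo) (fun C : R => Ad * (pi - C) `^ (d%:R / 2)),
          stieltjes_equiv (N_enc eps lambda) density,
          distr_equiv (rho_enc eps lambda) density &
          forall alpha B : R, 0 < B ->
            stieltjes_equiv (N_enc eps lambda)
              (fun C : R => B * (pi - C) `^ alpha) \/
            distr_equiv (rho_enc eps lambda)
              (fun C : R => B * (pi - C) `^ alpha) ->
            d%:R = 2 * alpha + 2].
Proof.
exists (fun d eps gamma => (eps * gamma) `^ (- (d%:R / 2))).
split=> [d eps gamma _ eps0 g0|]; first by rewrite powR_gt0// mulr_gt0.
move=> d M lambda eps gamma d0 [l0 lh _] eps0 g0 weyl Ad density.
have Ad0 : 0 < Ad by rewrite powR_gt0// mulr_gt0.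
have h0 : 0 < d%:R / 2 :> R by rewrite divr_gt0// ltr0n.
have [lub NA] := N_enc_equiv _ _ _ _ _ d0 eps0 g0 l0 lh weyl.
have Nni := N_enc_nonincreasing _ _ _ eps0 lh lub.
have densE : density = (fun C : R => d%:R / 2 * Ad * (pi - C) `^ (d%:R / 2 - 1)).
  by apply/funext => C; congr (_ * _ `^ _); field.
have dN : distr_equiv (rho_enc eps lambda) density.
  by rewrite densE; exact: (distr_equiv_density _ _ _ _ Ad0 h0 NA Nni).
split=> //; first by rewrite densE; exact: (stieltjes_equiv_density _ _ _ _ Ad0 h0 NA).
move=> alpha B B0 H; suff : alpha + 1 = d%:R / 2 by lra.
case: H => [|H]; first exact: (stieltjes_exponent _ _ _ _ _ Ad0 h0 B0 _ NA).
by rewrite densE in dN; exact: (distr_exponent _ _ _ _ _ Ad0 h0 B0 _ dN).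
Qed.
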